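(* (Absence of stuck states, TX10) If a TX10 configuration $k$ is terminal, i.e. (for the executing place $p$) there are no $\lambda,k'$ with $k\xrightarrow{\lambda}_p k'$, then $k$ is of the form $g$ (a global heap).
   Context: **Syntax.** $\mathsf{Pl}=\{0,\dots,n-1\}$ is a finite set of places (ranged over by $p,q$). $\mathsf{ObjId}$ is an infinite set of object ids with a fixed bijection with $\mathbb N$ (the enumeration order); $\mathsf p:\mathsf{ObjId}\to\mathsf{Pl}$ gives the home place; $\mathsf{ObjId}_q=\{o:\mathsf p(o)=q\}$; global references are $\mathsf{grObjId}=\{o\$p : o\in\mathsf{ObjId}_p,\ p\in\mathsf{Pl}\}$. Values $v$: object ids $o$, global references $o\$p$, exception constants $\mathsf E,\mathsf{BF},\mathsf{BG},\mathsf{DP}$. Expressions: $e::= v\mid x\mid e.f\mid\{f_1{:}e_1,\dots,f_n{:}e_n\}\mid \mathtt{globalref}\ e\mid\mathtt{valof}\ e$. Statements: $s,t::=\mathtt{skip}\mid\mathtt{throw}\ v$ ($v$ an exception value) $\mid \mathtt{val}\ x=e\ s\mid e.f=e'\mid\{s\ t\}\mid\mathtt{at}(p)(\mathtt{val}\ x=e)\,s\mid\mathtt{async}\ s\mid\mathtt{finish}\ s\mid\mathtt{try}\ s\ \mathtt{catch}\ t$, plus the dynamic (runtime only) statements $\overline{\mathtt{at}}(p)\,s\mid\overline{\mathtt{async}}\,s\mid\mathtt{finish}_\mu\,s$ with $\mu$ a possibly empty set of (exception) values; $\mathtt{finish}\ s$ abbreviates $\mathtt{finish}_\emptyset\,s$.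 In $\mathtt{val}\ x=e\ s$ and $\mathtt{at}(p)(\mathtt{val}\ x=e)s$ the only free variable of $s$ is $x$. **Heaps.** A local heap $h$ is a partial map from object ids to objects, an object being a partial map from field names to values. In TX10 (no place failure) a global heap $g$ maps every place of $\mathsf{Pl}$ to a local heap. $f[a\mapsto b]$ denotes map update. **Predicates.** $\mathsf{isAsync}(\overline{\mathtt{async}}\,s)$; $\mathsf{isAsync}(s)$ implies $\mathsf{isAsync}(\overline{\mathtt{at}}(p)s)$ and $\mathsf{isAsync}(\mathtt{try}\,s\,\mathtt{catch}\,t)$; $\mathsf{isAsync}(s)$ and $\mathsf{isAsync}(t)$ imply $\mathsf{isAsync}(\{s\ t\})$. **Transitions.** Configurations are $\langle s,g\rangle$ or $g$ (terminated). Labels $\lambda$: $\epsilon$ (normal), $v\otimes$ (synchronous exception), $v\times$ (asynchronous exception). $k\xrightarrow{\lambda}_p k'$ means that $k$ executing at place $p$ can in one step evolve to $k'$; $\to_p$ means $\xrightarrow{\epsilon}_p$. In rules, ''$A\mid B$'' in premise and conclusion denotes two rules, matching first with first and second with second. *Expressions* (at place $p$, local heap $h$): $\langle\{f_1{:}v_1,\dots,f_n{:}v_n\},h\rangle\to_p\langle o,h[o\mapsto\{f_i\mapsto v_i\}]\rangle$ with $o\in\mathsf{ObjId}_p\setminus\mathrm{dom}(h)$; $\langle o.f,h\rangle\to_p\langle v,h\rangle$ if $h(o)(f)=v$; $\langle o.f,h\rangle\xrightarrow{\mathsf{BF}\otimes}_p h$ if $f\notin\mathrm{dom}(h(o))$;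 $\langle\mathtt{globalref}\ o,h\rangle\to_p\langle o\$p,h\rangle$; $\langle\mathtt{valof}\ o\$p,h\rangle\to_p\langle o,h\rangle$; $\langle\mathtt{valof}\ v,h\rangle\xrightarrow{\mathsf{BG}\otimes}_p h$ if $v$ is not of the form $o\$p$; and if $\langle e,h\rangle\xrightarrow{\lambda}_p\langle e',h'\rangle\mid h$ then the same label is taken in the contexts $[\,].f$, $\mathtt{globalref}\,[\,]$, $\mathtt{valof}\,[\,]$, $\{f_1{:}v_1,\dots,f_i{:}v_i,f_{i+1}{:}[\,],\dots\}$ (leading to $h$ in the exceptional case). *Basic statements* (all require $p\in\mathrm{dom}(g)$): $\langle\mathtt{skip},g\rangle\to_p g$; $\langle\mathtt{throw}\ v,g\rangle\xrightarrow{v\otimes}_p g$; if $\langle s[v/x],g\rangle\xrightarrow{\lambda}_p\langle s',g'\rangle\mid g'$ then $\langle\mathtt{val}\ x=v\ s,g\rangle\xrightarrow{\lambda}_p\langle s',g'\rangle\mid g'$; $\langle o.f=v,g\rangle\to_p g[p\mapsto g(p)[o\mapsto g(p)(o)[f\mapsto v]]]$ if $f\in\mathrm{dom}(g(p)(o))$; $\langle o.f=v,g\rangle\xrightarrow{\mathsf{BF}\otimes}_p g$ if $f\notin\mathrm{dom}(g(p)(o))$; (Ctx) if $\langle e,g(p)\rangle\xrightarrow{\lambda}_p\langle e',h'\rangle\mid h'$ and $g'=g[p\mapsto h']$ then $\mathtt{val}\ x=e\ s$, $e.f=e_1$, $o.f=e$, $\mathtt{at}(q)(\mathtt{val}\ x=e)s$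 in heap $g$ make a $\lambda$-step at $p$ to the same statement with $e'$ for $e$ in heap $g'$, resp. to $g'$. *Copy.* For $o\in\mathsf{ObjId}$ with $\mathsf p(o)\in\mathrm{dom}(g)$ and $q\in\mathrm{dom}(g)$, $\mathsf{copy}(o,q,g)=(o',g[q\mapsto h'])$ where $h'$ extends $h=g(q)$ by a fresh isomorphic copy, rooted at $o'$, of the object graph reachable from $o$ in $g(\mathsf p(o))$; the new ids are the next elements of $\mathsf{ObjId}_q$ and global references are preserved unchanged. For other values $\mathsf{copy}(v,q,g)=(v,g)$. *Remaining TX10 rules:* (Spawn) $\langle\mathtt{async}\ s,g\rangle\to_p\langle\overline{\mathtt{async}}\,s,g\rangle$. (Async) if $\langle s,g\rangle\xrightarrow{\lambda}_p\langle s',g'\rangle\mid g'$ then $\langle\overline{\mathtt{async}}\,s,g\rangle\xrightarrow{\lambda'}_p\langle\overline{\mathtt{async}}\,s',g'\rangle\mid g'$, with $\lambda'=\epsilon$ if $\lambda=\epsilon$ and $\lambda'=v\times$ if $\lambda\in\{v\times,v\otimes\}$. (Finish) if $\langle s,g\rangle\xrightarrow{\lambda}_p\langle s',g'\rangle$ then $\langle\mathtt{finish}_\mu s,g\rangle\to_p\langle\mathtt{finish}_{\mu\cup\lambda}s',g'\rangle$, where $\mu\cup\epsilon=\mu$ and $\mu\cup v\times=\mu\cup v\otimes=\mu\cup\{v\}$. (End of Finish) if $\langle s,g\rangle\xrightarrow{\lambda}_p g'$ then $\langle\mathtt{finish}_\mu s,g\rangle\xrightarrow{\lambda'}_p g'$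 with $\lambda'=\epsilon$ if $\mu\cup\lambda=\emptyset$, else $\lambda'=\mathsf E\otimes$. (Seq) if $\langle s,g\rangle\xrightarrow{\lambda}_p\langle s',g'\rangle\mid g'$: if $\lambda\in\{\epsilon,v\times\}$, $\langle\{s\ t\},g\rangle\xrightarrow{\lambda}_p\langle\{s'\ t\},g'\rangle\mid\langle t,g'\rangle$; if $\lambda=v\otimes$, $\langle\{s\ t\},g\rangle\xrightarrow{\lambda}_p\langle s',g'\rangle\mid g'$. (Par) if $\mathsf{isAsync}(t)$ and $\langle s,g\rangle\xrightarrow{\lambda}_p\langle s',g'\rangle\mid g'$ then $\langle\{t\ s\},g\rangle\xrightarrow{\lambda}_p\langle\{t\ s'\},g'\rangle\mid\langle t,g'\rangle$. (Place Shift) if $(v',g')=\mathsf{copy}(v,q,g)$ then $\langle\mathtt{at}(q)(\mathtt{val}\ x=v)s,g\rangle\to_p\langle\overline{\mathtt{at}}(q)\{s[v'/x]\ \mathtt{skip}\},g'\rangle$. (At) if $\langle s,g\rangle\xrightarrow{\lambda}_q\langle s',g'\rangle\mid g'$ then $\langle\overline{\mathtt{at}}(q)s,g\rangle\xrightarrow{\lambda}_p\langle\overline{\mathtt{at}}(q)s',g'\rangle\mid g'$. (Try) if $\langle s,g\rangle\xrightarrow{\lambda}_p\langle s',g'\rangle\mid g'$: if $\lambda\in\{\epsilon,v\times\}$, $\langle\mathtt{try}\,s\,\mathtt{catch}\,t,g\rangle\xrightarrow{\lambda}_p\langle\mathtt{try}\,s'\,\mathtt{catch}\,t,g'\rangle\mid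 g'$; if $\lambda=v\otimes$, $\langle\mathtt{try}\,s\,\mathtt{catch}\,t,g\rangle\to_p\langle\{s'\ t\},g'\rangle\mid\langle t,g'\rangle$.
   Formalization: Restricted to closed statements, finite heaps and objects, infinite ObjId_q, and configurations whose leftmost next operation is not v.f or v.f=e with v not an object id, nor globalref v at p with v not in ObjId_p: no rule covers these, so e.g. val x=E.f skip is stuck. *)

(* Defs.v *)
From HB Require Import structures.
From mathcomp Require Import all_boot finmap.

Set Implicit Arguments.
Unset Strict Implicit.
Unset Printing Implicit Defensive.

Local Open Scope fset_scope.
Local Open Scope fmap_scope.

(* [oid_index] is the fixed bijection of ObjId with N.  [home_infinite] says that
   each ObjId_q is infinite: fresh ids of every place never run out. *)
Record setting := Setting {
  nplaces : nat;
  ObjId : choiceType;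
  oid_index : ObjId -> nat;
  oid_index_bij : bijective oid_index;
  home : ObjId -> 'I_nplaces;
  home_infinite : forall (q : 'I_nplaces) (m : nat),
    exists2 o : ObjId, home o = q & m <= oid_index o;
  FieldName : choiceType;
  Var : eqType
}.

Definition Pl (S : setting) := 'I_(nplaces S).

(** * Syntax *)

Inductive exn := ExnE | ExnBF | ExnBG | ExnDP.

Definition exn_code (v : exn) : 'I_4 :=
  match v with
  | ExnE => inord 0 | ExnBF => inord 1 | ExnBG => inord 2 | ExnDP => inord 3
  end.

Definition exn_decode (i : 'I_4) : exn :=
  match val i with 0 => ExnE | 1 => ExnBF | 2 => ExnBG | _ => ExnDP end.

Lemma exn_codeK : cancel exn_code exn_decode.
Proof. by case; rewrite /exn_decode /= inordK. Qed.

HB.instance Definition _ := Finite.copy exn (can_type exn_codeK).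

(* o$p belongs to grObjId exactly when p is the home of o, so that the global
   reference o$(home o) is represented by o alone. *)
Inductive value (S : setting) :=
  | VObj of ObjId S
  | VGlob of ObjId S
  | VExn of exn.
Arguments VExn {S} _.

Inductive expr (S : setting) :=
  | EVal of value S
  | EVar of Var S
  | EField of expr S & FieldName S
  | ERec of seq (FieldName S * expr S)
  | EGlobalRef of expr S
  | EValOf of expr S.

(* [SAt q x e s] is at(q)(val x = e) s.  [SDynAt] and [SDynAsync] are the
   overlined forms; finish s is [SFinish set0 s]. *)
Inductive stmt (S : setting) :=
  | SSkip
  | SThrow of exn
  | SVal of Var S & expr S & stmt S
  | SAssign of expr S & FieldName S & expr S
  | SSeq of stmt S & stmt S
  | SAt of Pl S & Var S & expr S & stmt S
  | SAsync of stmt S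
  | SFinish of {set exn} & stmt S
  | STry of stmt S & stmt S
  | SDynAt of Pl S & stmt S
  | SDynAsync of stmt S.
Arguments SSkip {S}.
Arguments SThrow {S} _.

Fixpoint efv (S : setting) (e : expr S) : seq (Var S) :=
  match e with
  | EVal _ => [::]
  | EVar x => [:: x]
  | EField e1 _ => efv e1
  | ERec fes => flatten [seq efv fe.2 | fe <- fes]
  | EGlobalRef e1 => efv e1
  | EValOf e1 => efv e1
  end.

Fixpoint sfv (S : setting) (s : stmt S) : seq (Var S) :=
  match s with
  | SSkip | SThrow _ => [::]
  | SVal x e s1 | SAt _ x e s1 => efv e ++ [seq y <- sfv s1 | y != x]
  | SAssign e1 _ e2 => efv e1 ++ efv e2
  | SSeq s1 s2 | STry s1 s2 => sfv s1 ++ sfv s2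
  | SAsync s1 | SFinish _ s1 | SDynAt _ s1 | SDynAsync s1 => sfv s1
  end.

Fixpoint scoped (S : setting) (s : stmt S) : bool :=
  match s with
  | SSkip | SThrow _ | SAssign _ _ _ => true
  | SVal x _ s1 | SAt _ x _ s1 => all (pred1 x) (sfv s1) && scoped s1
  | SSeq s1 s2 | STry s1 s2 => scoped s1 && scoped s2
  | SAsync s1 | SFinish _ s1 | SDynAt _ s1 | SDynAsync s1 => scoped s1
  end.

Fixpoint esubst (S : setting) (x : Var S) (v : value S) (e : expr S) : expr S :=
  match e with
  | EVal w => EVal w
  | EVar y => if y == x then EVal v else EVar y
  | EField e1 f => EField (esubst x v e1) f
  | ERec fes => ERec [seq (fe.1, esubst x v fe.2) | fe <- fes]
  | EGlobalRef e1 => EGlobalRef (esubst x v e1)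
  | EValOf e1 => EValOf (esubst x v e1)
  end.

Fixpoint ssubst (S : setting) (x : Var S) (v : value S) (s : stmt S) : stmt S :=
  match s with
  | SSkip => SSkip
  | SThrow w => SThrow w
  | SVal y e s1 =>
      SVal y (esubst x v e) (if y == x then s1 else ssubst x v s1)
  | SAssign e1 f e2 => SAssign (esubst x v e1) f (esubst x v e2)
  | SSeq s1 s2 => SSeq (ssubst x v s1) (ssubst x v s2)
  | SAt q y e s1 =>
      SAt q y (esubst x v e) (if y == x then s1 else ssubst x v s1)
  | SAsync s1 => SAsync (ssubst x v s1)
  | SFinish mu s1 => SFinish mu (ssubst x v s1)
  | STry s1 s2 => STry (ssubst x v s1) (ssubst x v s2)
  | SDynAt q s1 => SDynAt q (ssubst x v s1)
  | SDynAsync s1 => SDynAsync (ssubst x v s1)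
  end.

Fixpoint is_async (S : setting) (s : stmt S) : bool :=
  match s with
  | SDynAsync _ => true
  | SDynAt _ s1 => is_async s1
  | STry s1 _ => is_async s1
  | SSeq s1 s2 => is_async s1 && is_async s2
  | _ => false
  end.

(** * Heaps *)

Definition object (S : setting) := {fmap FieldName S -> value S}.
Definition heap (S : setting) := {fmap ObjId S -> object S}.

(* Places do not fail in TX10: dom(g) is the whole of Pl. *)
Definition gheap (S : setting) := {ffun Pl S -> heap S}.

Definition gset (S : setting) (g : gheap S) (p : Pl S) (h : heap S) : gheap S :=
  [ffun q => if q == p then h else g q].

(* h(o)(f); it is undefined, and f is not in dom(h(o)), if o is not in dom(h). *)
Definition lookup (S : setting) (h : heap S) (o : ObjId S) (f : FieldName S) :
    option (value S) :=
  obind (fun r : object S => r.[? f]) h.[? o].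

Definition record_object (S : setting)
    (fvs : seq (FieldName S * value S)) : object S :=
  foldl (fun (r : object S) fv => r.[fv.1 <- fv.2]) [fmap] fvs.

(** * Copy *)

Inductive reachable (S : setting) (h : heap S) (o : ObjId S) : ObjId S -> Prop :=
  | ReachRoot : reachable h o o
  | ReachField x f y :
      reachable h o x -> lookup h x f = Some (VObj y) -> reachable h o y.

Definition map_value (S : setting) (phi : ObjId S -> ObjId S) (v : value S) :=
  if v is VObj o then VObj (phi o) else v.

Definition map_object (S : setting) (phi : ObjId S -> ObjId S) (r : object S) :
    object S :=
  [fmap f : domf r => map_value phi (r f)].

(* [h'] extends [h] by a copy of the graph reachable from [o] in [h0], along the
   renaming [phi].  The new ids are the first elements of ObjId_q not in dom(h),
   and they are allotted in enumeration order; this makes [phi] injective and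
   determines it on the reachable ids, so that [copy] is functional.
   A reachable id outside dom(h0) is renamed too, to an id outside dom(h'). *)
Record graph_copy (S : setting) (h0 : heap S) (o : ObjId S) (q : Pl S)
    (h : heap S) (phi : ObjId S -> ObjId S) (h' : heap S) : Prop := GraphCopy {
  copy_fresh : forall x, reachable h0 o x ->
    home (phi x) = q /\ phi x \notin domf h;
  copy_next : forall x y, reachable h0 o x ->
    home y = q -> y \notin domf h -> oid_index y < oid_index (phi x) ->
    exists2 z, reachable h0 o z & y = phi z;
  copy_order : forall x y, reachable h0 o x -> reachable h0 o y ->
    oid_index x < oid_index y -> oid_index (phi x) < oid_index (phi y);
  copy_new : forall x, reachable h0 o x ->
    h'.[? phi x] = omap (map_object phi) h0.[? x];
  copy_old : forall y, (forall x, reachable h0 o x -> y <> phi x) ->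
    h'.[? y] = h.[? y]
}.

(* [copy v q g v' g'] is copy(v, q, g) = (v', g'). *)
Inductive copy (S : setting) :
    value S -> Pl S -> gheap S -> value S -> gheap S -> Prop :=
  | CopyObj o q (g : gheap S) phi h' :
      graph_copy (g (home o)) o q (g q) phi h' ->
      copy (VObj o) q g (VObj (phi o)) (gset g q h')
  | CopyOther v q (g : gheap S) :
      (forall o, v <> VObj o) -> copy v q g v g.

(** * Transitions *)

(* Configurations with program part in [A] and heap in [H]. *)
Inductive config (A H : Type) :=
  | Run of A & H
  | Done of H.
Arguments Run {A H} _ _.
Arguments Done {A H} _.

Definition econfig (S : setting) := config (expr S) (heap S).
Definition sconfig (S : setting) := config (stmt S) (gheap S).

(* [in_ctx] and [in_ctx_or] transport the alternatives "A | B" of the rules: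
   <s,g> | g becomes <C s,g> | g, respectively <C s,g> | <t,g>. *)
Definition in_ctx (A B H : Type) (C : A -> B) (k : config A H) : config B H :=
  match k with Run a h => Run (C a) h | Done h => Done h end.

Definition in_ctx_or (A B H : Type) (C : A -> B) (t : B) (k : config A H) :
    config B H :=
  match k with Run a h => Run (C a) h | Done h => Run t h end.

Definition in_heap (A H G : Type) (F : H -> G) (k : config A H) : config A G :=
  match k with Run a h => Run a (F h) | Done h => Done (F h) end.

Inductive label := LEps | LSync of exn | LAsync of exn.

Definition async_label (l : label) : label :=
  match l with LEps => LEps | LSync v | LAsync v => LAsync v end.

Definition add_label (mu : {set exn}) (l : label) : {set exn} :=
  match l with LEps => mu | LSync v | LAsync v => v |: mu end.

Definition is_sync (l : label) : bool := if l is LSync _ then true else false.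

Inductive estep (S : setting) (p : Pl S) :
    econfig S -> label -> econfig S -> Prop :=
  | StepNewObj fvs o h :
      home o = p -> o \notin domf h ->
      estep p (Run (ERec [seq (fv.1, EVal fv.2) | fv <- fvs]) h)
        LEps (Run (EVal (VObj o)) h.[o <- record_object fvs])
  | StepSelect o f v h :
      lookup h o f = Some v ->
      estep p (Run (EField (EVal (VObj o)) f) h) LEps (Run (EVal v) h)
  | StepSelectBad o f h :
      lookup h o f = None ->
      estep p (Run (EField (EVal (VObj o)) f) h) (LSync ExnBF) (Done h)
  | StepGlobalRef o h :
      home o = p ->
      estep p (Run (EGlobalRef (EVal (VObj o))) h) LEps (Run (EVal (VGlob o)) h)
  | StepValOf o h :
      home o = p ->
      estep p (Run (EValOf (EVal (VGlob o))) h) LEps (Run (EVal (VObj o)) h)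
  | StepValOfBad v h :
      (forall o, home o = p -> v <> VGlob o) ->
      estep p (Run (EValOf (EVal v)) h) (LSync ExnBG) (Done h)
  | StepCtxField e f h l k :
      estep p (Run e h) l k ->
      estep p (Run (EField e f) h) l (in_ctx (fun e' => EField e' f) k)
  | StepCtxGlobalRef e h l k :
      estep p (Run e h) l k ->
      estep p (Run (EGlobalRef e) h) l (in_ctx (@EGlobalRef S) k)
  | StepCtxValOf e h l k :
      estep p (Run e h) l k ->
      estep p (Run (EValOf e) h) l (in_ctx (@EValOf S) k)
  | StepCtxRec fvs f e fes h l k :
      estep p (Run e h) l k ->
      estep p
        (Run (ERec ([seq (fv.1, EVal fv.2) | fv <- fvs] ++ (f, e) :: fes)) h) l
        (in_ctx (fun e' =>
           ERec ([seq (fv.1, EVal fv.2) | fv <- fvs] ++ (f, e') :: fes)) k).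

(* The statement contexts of an expression: val x=[] s, [].f=e1, o.f=[] and
   at(q)(val x=[]) s. *)
Inductive expr_ctx (S : setting) : (expr S -> stmt S) -> Prop :=
  | CtxVal x s : expr_ctx (fun e => SVal x e s)
  | CtxAssignL f e1 : expr_ctx (fun e => SAssign e f e1)
  | CtxAssignR o f : expr_ctx (fun e => SAssign (EVal (VObj o)) f e)
  | CtxAt q x s : expr_ctx (fun e => SAt q x e s).

Inductive step (S : setting) :
    Pl S -> sconfig S -> label -> sconfig S -> Prop :=
  | StepSkip p g :
      step p (Run SSkip g) LEps (Done g)
  | StepThrow p v g :
      step p (Run (SThrow v) g) (LSync v) (Done g)
  | StepVal p x v s g l k :
      step p (Run (ssubst x v s) g) l k ->
      step p (Run (SVal x (EVal v) s) g) l k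
  | StepAssign p o f v (g : gheap S) r :
      (g p).[? o] = Some r -> f \in domf r ->
      step p (Run (SAssign (EVal (VObj o)) f (EVal v)) g) LEps
        (Done (gset g p (g p).[o <- r.[f <- v]]))
  | StepAssignBad p o f v (g : gheap S) :
      lookup (g p) o f = None ->
      step p (Run (SAssign (EVal (VObj o)) f (EVal v)) g) (LSync ExnBF) (Done g)
  | StepCtx p C e (g : gheap S) l k :
      expr_ctx C -> estep p (Run e (g p)) l k ->
      step p (Run (C e) g) l (in_heap (gset g p) (in_ctx C k))
  | StepSpawn p s g :
      step p (Run (SAsync s) g) LEps (Run (SDynAsync s) g)
  | StepAsync p s g l k :
      step p (Run s g) l k ->
      step p (Run (SDynAsync s) g) (async_label l) (in_ctx (@SDynAsync S) k)
  | StepFinish p mu s g l s' g' :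
      step p (Run s g) l (Run s' g') ->
      step p (Run (SFinish mu s) g) LEps (Run (SFinish (add_label mu l) s') g')
  | StepEndFinish p mu s g l g' :
      step p (Run s g) l (Done g') ->
      step p (Run (SFinish mu s) g)
        (if add_label mu l == set0 then LEps else LSync ExnE) (Done g')
  | StepSeq p s t g l k :
      step p (Run s g) l k -> ~~ is_sync l ->
      step p (Run (SSeq s t) g) l (in_ctx_or (fun s' => SSeq s' t) t k)
  | StepSeqExn p s t g v k :
      step p (Run s g) (LSync v) k ->
      step p (Run (SSeq s t) g) (LSync v) k
  | StepPar p s t g l k :
      is_async t -> step p (Run s g) l k ->
      step p (Run (SSeq t s) g) l (in_ctx_or (fun s' => SSeq t s') t k)
  | StepPlaceShift p q x v s g v' g' :
      copy v q g v' g' ->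
      step p (Run (SAt q x (EVal v) s) g) LEps
        (Run (SDynAt q (SSeq (ssubst x v' s) SSkip)) g')
  | StepAt p q s g l k :
      step q (Run s g) l k ->
      step p (Run (SDynAt q s) g) l (in_ctx (SDynAt q) k)
  | StepTry p s t g l k :
      step p (Run s g) l k -> ~~ is_sync l ->
      step p (Run (STry s t) g) l (in_ctx (fun s' => STry s' t) k)
  | StepTryCatch p s t g v k :
      step p (Run s g) (LSync v) k ->
      step p (Run (STry s t) g) LEps (in_ctx_or (fun s' => SSeq s' t) t k).

Definition terminal (S : setting) (p : Pl S) (k : sconfig S) : Prop :=
  ~ exists l k', step p k l k'.

(** * Well-formed configurations *)

(* The rules give no meaning to v.f and v.f=e for v not an object id, nor to
   globalref v at p for v not an object id of ObjId_p (v$p is then not a global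
   reference); the language tacitly excludes such misapplied operations.
   [emisapplied p e] and [misapplied p s] say that the next operation of e or s,
   executing at p, is misapplied.  In {s t} the next operation is taken in s: by
   (Par) one in t may also be enabled, but it is left unconstrained. *)
Inductive emisapplied (S : setting) (p : Pl S) : expr S -> Prop :=
  | MisField v f :
      (forall o, v <> VObj o) -> emisapplied p (EField (EVal v) f)
  | MisGlobalRef v :
      (forall o, home o = p -> v <> VObj o) ->
      emisapplied p (EGlobalRef (EVal v))
  | MisCtxField e f : emisapplied p e -> emisapplied p (EField e f)
  | MisCtxGlobalRef e : emisapplied p e -> emisapplied p (EGlobalRef e)
  | MisCtxValOf e : emisapplied p e -> emisapplied p (EValOf e)
  | MisCtxRec fvs f e fes :
      emisapplied p e ->
      emisapplied p (ERec ([seq (fv.1, EVal fv.2) | fv <- fvs] ++ (f, e) :: fes)).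

Inductive misapplied (S : setting) : Pl S -> stmt S -> Prop :=
  | MisAssign p v f e :
      (forall o, v <> VObj o) -> misapplied p (SAssign (EVal v) f e)
  | MisCtx p C e : expr_ctx C -> emisapplied p e -> misapplied p (C e)
  | MisVal p x v s :
      misapplied p (ssubst x v s) -> misapplied p (SVal x (EVal v) s)
  | MisSeq p s t : misapplied p s -> misapplied p (SSeq s t)
  | MisTry p s t : misapplied p s -> misapplied p (STry s t)
  | MisFinish p mu s : misapplied p s -> misapplied p (SFinish mu s)
  | MisAsync p s : misapplied p s -> misapplied p (SDynAsync s)
  | MisAt p q s : misapplied q s -> misapplied p (SDynAt q s).

Definition well_formed (S : setting) (p : Pl S) (k : sconfig S) : Prop :=
  match k with
  | Run s _ => [/\ sfv s = [::], scoped s & ~ misapplied p s]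
  | Done _ => True
  end.

(* Main.v *)
(** Every well-formed statement can step, by induction on its size: the step of
    val x=v s is one of s[v/x], which is not a substatement but has the size of
    s.  Evaluation follows the leftmost redex, so (Par) is never needed.  The
    only premise that calls for a construction is the copy of (Place Shift): the
    ids reachable from the root are finitely many, and listed in enumeration
    order they are sent to the first fresh ids of the target place. *)

From mathcomp Require Import all_boot finmap.
From Stdlib Require Import Classical.
Require Import Defs.

Set Implicit Arguments.
Unset Strict Implicit.
Unset Printing Implicit Defensive.

Local Open Scope fset_scope.
Local Open Scope fmap_scope.

(** * Free variables, scoping and size under substitution of a value *)

Section Substitution.
Variable S : setting.
Implicit Types (x : Var S) (v : value S) (e : expr S) (s : stmt S).

(* The generated principle [expr_ind] has no hypothesis for the fields of a
   record. *)
Lemma expr_nested_ind (P : expr S -> Prop) :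
  (forall v, P (EVal v)) -> (forall x, P (EVar x)) ->
  (forall e f, P e -> P (EField e f)) ->
  (forall fes, foldr (fun fe => and (P fe.2)) True fes -> P (ERec fes)) ->
  (forall e, P e -> P (EGlobalRef e)) -> (forall e, P e -> P (EValOf e)) ->
  forall e, P e.
Proof.
move=> Pval Pvar Pfield Prec Pglob Pvalof; fix IH 1 => -[v|x|e f|fes|e|e].
- exact: Pval.
- exact: Pvar.
- exact/Pfield/IH.
- by apply: Prec; elim: fes => //=.
- exact/Pglob/IH.
- exact/Pvalof/IH.
Qed.

Lemma efv_esubst x v e : efv (esubst x v e) = [seq y <- efv e | y != x].
Proof.
elim/expr_nested_ind: e => //= [y|fes IH]; first by case: eqP.
by rewrite filter_flatten; elim: fes IH => [|fe fes IHfes] //= [-> /IHfes ->].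
Qed.

Lemma sfv_ssubst x v s : sfv (ssubst x v s) = [seq y <- sfv s | y != x].
Proof.
(* Both binders reduce to this: if [y] is [x], substitution stops and the second filter is
   idempotent; otherwise the two filters commute. *)
have bind y s1 : sfv (ssubst x v s1) = [seq z <- sfv s1 | z != x] ->
    [seq z <- sfv (if y == x then s1 else ssubst x v s1) | z != y]
    = [seq z <- [seq z <- sfv s1 | z != y] | z != x].
  move=> IHs; case: eqP => [->|_]; first by rewrite filter_id.
  by rewrite IHs -!filter_predI; apply: eq_filter => z /=; rewrite andbC.
elim: s => //= [y e s1 /bind IHs|e1 f e2|s1 IH1 s2 IH2|q y e s1 /bind IHs
               |s1 IH1 s2 IH2].
- by rewrite efv_esubst filter_cat IHs.
- by rewrite !efv_esubst filter_cat.
- by rewrite filter_cat IH1 IH2.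
- by rewrite efv_esubst filter_cat IHs.
- by rewrite filter_cat IH1 IH2.
Qed.

(** Substitution only removes free variables, so a body whose only free variable was its binder
    keeps that property. *)
Lemma scoped_ssubst x v s : scoped s -> scoped (ssubst x v s).
Proof.
have bind y s1 : (scoped s1 -> scoped (ssubst x v s1)) ->
    all (pred1 y) (sfv s1) && scoped s1 ->
    all (pred1 y) (sfv (if y == x then s1 else ssubst x v s1))
    && scoped (if y == x then s1 else ssubst x v s1).
  move=> IHs /andP[fv_s1 sc_s1]; case: ifP => _; apply/andP => //.
  split; last exact: IHs.
  by rewrite sfv_ssubst all_filter; apply: sub_all fv_s1 => z /= ->;
    rewrite implybT.
elim: s => //= [y e s1 IHs|s1 IH1 s2 IH2|q y e s1 IHs|s1 IH1 s2 IH2].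
- exact: bind.
- by case/andP => /IH1-> /IH2->.
- exact: bind.
- by case/andP => /IH1-> /IH2->.
Qed.

(** Expressions contribute nothing, which is what makes the size invariant under substitution. *)
Fixpoint ssize s : nat :=
  match s with
  | SSkip | SThrow _ | SAssign _ _ _ => 1
  | SVal _ _ s1 | SAt _ _ _ s1 | SAsync s1 | SFinish _ s1 | SDynAt _ s1
  | SDynAsync s1 => (ssize s1).+1
  | SSeq s1 s2 | STry s1 s2 => (ssize s1 + ssize s2).+1
  end.

Lemma ssize_ssubst x v s : ssize (ssubst x v s) = ssize s.
Proof.
by elim: s => //= [y e s1 IH|s1 -> s2 ->|q y e s1 IH|s1 ->|mu s1 ->|s1 -> s2 ->
                 |q s1 ->|s1 ->] //; case: ifP; rewrite ?IH.
Qed.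

End Substitution.

(** * Fresh ids and copies of object graphs *)

Section Copying.
Variable S : setting.
Implicit Types (h : heap S) (o x y : ObjId S) (q : Pl S).

Lemma fresh_unbounded h q m :
  exists o, [/\ home o = q, o \notin domf h & m <= oid_index o].
Proof.
(* An index beyond those of all ids in [domf h] forces freshness. *)
have [o home_o le_o] :=
  home_infinite q (maxn m (\max_(y <- domf h) oid_index y).+1).
exists o; split=> //; last exact: leq_trans (leq_maxl _ _) le_o.
apply/negP => o_h; have /leq_trans/(_ le_o) := leq_maxr m
  (\max_(y <- domf h) oid_index y).+1.
by rewrite ltnNge leq_bigmax_seq.
Qed.

(** Filtering an initial segment of the naturals through the enumeration gives a list that is
    increasing and, among the fresh ids of [q], closed downwards. *)
Lemma fresh_prefix h q n : exists B : seq (ObjId S),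
  [/\ n <= size B, sorted (fun x y => oid_index x < oid_index y) B,
      (forall y, y \in B -> home y = q /\ y \notin domf h)
    & forall x y, x \in B -> home y = q -> y \notin domf h ->
        oid_index y < oid_index x -> y \in B].
Proof.
have [u uK Ku] := oid_index_bij S.
pose P m := (home (u m) == q) && (u m \notin domf h).
(* Extending the segment just past one more fresh id of index at least [N] raises the count by at
   least one. *)
have [N leN] : exists N, n <= count P (iota 0 N).
  elim: n => [|n [N leN]]; first by exists 0.
  have [o [home_o o_h leo]] := fresh_unbounded h q N.
  exists (oid_index o).+1.
  rewrite -[(oid_index o).+1]addn1 iotaD count_cat /= /P uK home_o eqxx o_h /= addn1 ltnS.
  by apply: leq_trans leN _; rewrite -(subnK leo) addnC iotaD count_cat leq_addr.
have memB y : y \in map u (filter P (iota 0 N)) ->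
    P (oid_index y) && (oid_index y < N).
  by case/mapP => m; rewrite mem_filter mem_iota => Pm ->; rewrite Ku.
exists (map u (filter P (iota 0 N))); split.
- by rewrite size_map size_filter.
- rewrite sorted_map; apply: (@sub_sorted _ ltn) => [a b|].
    by rewrite /= !Ku.
  by apply: sorted_filter (iota_ltn_sorted _ _); apply: ltn_trans.
- by move=> y /memB /andP[]; rewrite /P uK => /andP[/eqP].
- move=> x y /memB/andP[_ ltx] home_y y_h lty; rewrite -[y]uK; apply: map_f.
  by rewrite mem_filter /P uK home_y eqxx y_h mem_iota /= (ltn_trans lty).
Qed.

(** Everything reachable is the root or is stored in a field of some object of the finite heap.
    Excluded middle then selects the reachable ids from this finite list [C]. *)
Lemma reachable_finite h o : exists A : seq (ObjId S),
  uniq A /\ forall x, x \in A <-> reachable h o x.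
Proof.
pose fields x : {fset FieldName S} := oapp (fun r : object S => domf r) fset0 h.[? x].
pose C := o :: pmap (fun xf => if lookup h xf.1 xf.2 is Some (VObj y) then Some y
                               else None)
                 [seq (x, f) | x <- enum_fset (domf h), f <- enum_fset (fields x)].
have RC x : reachable h o x -> x \in C.
  case=> [|{}x f y _ xfy]; first exact: mem_head.
  rewrite inE mem_pmap; apply/orP; right; apply/mapP; exists (x, f);
    rewrite /= ?xfy //.
  move: xfy; rewrite /lookup; case E: h.[? x] => [r|] //= rf.
  apply/allpairsPdep; exists x, f; split=> //.
    by rewrite -fndSome E.
  by rewrite /fields E /= -fndSome rf.
suff [A memA] : exists A : seq (ObjId S), forall x,
    x \in A <-> x \in C /\ reachable h o x.
  exists (undup A); split=> [|x]; first exact: undup_uniq.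
  by rewrite mem_undup memA; split=> [[]|/[dup]/RC].
elim: {RC} C => [|y C [A memA]]; first by exists nil => x; split=> // -[].
case: (classic (reachable h o y)) => [Ry|nRy].
  exists (y :: A) => x; rewrite !inE; split.
    by case/predU1P => [->|/memA[-> ?]]; rewrite ?eqxx ?orbT.
  by case=> /predU1P[->|xC Rx]; rewrite ?eqxx //; apply/orP; right; apply/memA.
exists A => x; rewrite memA inE; split=> [[-> ?]|[/predU1P[->|]]] //.
by rewrite orbT.
Qed.

(** Objects are inserted one by one; injectivity keeps an insertion from overwriting a copy already
    made. *)
Lemma copy_along h0 h (phi : ObjId S -> ObjId S) (A : seq (ObjId S)) :
  uniq A -> {in A &, injective phi} -> {in A, forall x, phi x \notin domf h} ->
  exists h' : heap S,
    {in A, forall x, h'.[? phi x] = omap (map_object phi) h0.[? x]} /\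
    forall y, (forall x, x \in A -> y <> phi x) -> h'.[? y] = h.[? y].
Proof.
elim: A => [|a A IH] /=; first by exists h.
case/andP => aA uA inj_phi fresh.
have [||h' [h'_new h'_old]] := IH uA.
- by move=> x y xA yA; apply: inj_phi; rewrite inE ?xA ?yA orbT.
- by move=> x xA; apply: fresh; rewrite inE xA orbT.
have phi_a x : x \in A -> phi a <> phi x.
  move=> xA /inj_phi ax; case/negP: aA; rewrite ax ?mem_head //.
  by rewrite inE xA orbT.
(* If [a] has no object in [h0], nothing is inserted, and [phi a] must still be undefined. *)
have h'a : h'.[? phi a] = None.
  by rewrite h'_old // not_fnd // fresh // mem_head.
case E: h0.[? a] => [r|].
  exists h'.[phi a <- map_object phi r]; split=> [x|y y_new].
    rewrite inE fnd_set => /predU1P[->|xA]; first by rewrite eqxx E.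
    by rewrite h'_new //; case: eqP => // /esym /phi_a; case.
  rewrite fnd_set; case: eqP => [/y_new[]|_]; first exact: mem_head.
  by apply: h'_old => x xA; apply: y_new; rewrite inE xA orbT.
exists h'; split=> [x|y y_new].
  by rewrite inE => /predU1P[->|]; [rewrite h'a E | apply: h'_new].
by apply: h'_old => x xA; apply: y_new; rewrite inE xA orbT.
Qed.

Lemma graph_copy_exists h0 o q h :
  exists (phi : ObjId S -> ObjId S) (h' : heap S), graph_copy h0 o q h phi h'.
Proof.
have [A0 [uA0 memA0]] := reachable_finite h0 o.
pose leI : rel (ObjId S) := relpre (@oid_index S) leq.
have leI_trans : transitive leI by move=> y x z; apply: leq_trans.
pose A := sort leI A0.
have uA : uniq A by rewrite sort_uniq.
have memA x : x \in A <-> reachable h0 o x by rewrite mem_sort.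
have sA : sorted leI A by apply: sort_sorted => x y; apply: leq_total.
have [B [leAB sB freshB closedB]] := fresh_prefix h q (size A).
pose lt : rel (ObjId S) := relpre (@oid_index S) ltn.
have lt_trans : transitive lt by move=> y x z; apply: ltn_trans.
have uB : uniq B by apply: sorted_uniq sB => // x; apply: ltnn.
(* The i-th reachable id goes to the i-th fresh id. The default [o] is never reached on [A], since
   [B] is at least as long. *)
pose phi x := nth o B (index x A).
have idxA x : x \in A -> index x A < size B.
  by rewrite -index_mem => /leq_trans; apply.
have phiB x : x \in A -> phi x \in B by move=> /idxA; apply: mem_nth.
have mono x y : x \in A -> y \in A -> oid_index x < oid_index y ->
    oid_index (phi x) < oid_index (phi y).
  move=> xA yA ltxy; apply: (sorted_ltn_nth lt_trans o sB); rewrite ?inE ?idxA //.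
  rewrite ltnNge leq_eqVlt; apply/negP => /orP[/eqP/(congr1 (nth o A))|lt_yx].
    by rewrite !nth_index // => yx; rewrite yx ltnn in ltxy.
  have := sorted_ltn_index leI_trans sA _ _ yA xA lt_yx.
  by rewrite /leI /= leqNgt ltxy.
have inj_phi : {in A &, injective phi}.
  move=> x y xA yA /eqP; rewrite nth_uniq ?idxA // => /eqP/(congr1 (nth o A)).
  by rewrite !nth_index.
have [|h' [h'_new h'_old]] := @copy_along h0 h phi A uA inj_phi.
  by move=> x /phiB/freshB[].
exists phi, h'; split.
- by move=> x /memA/phiB/freshB.
- move=> x y /memA xA home_y y_h lty.
  have yB := closedB _ _ (phiB x xA) home_y y_h lty.
  (* Since [B] is increasing, a fresh id below [phi x] sits at an earlier position, hence is the
     image of the entry of [A] there. *)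
  have lt_i : index y B < index x A.
    rewrite ltnNge leq_eqVlt; apply/negP => /orP[/eqP xy|lt_xy].
      by move: lty; rewrite /phi xy nth_index // ltnn.
    have := sorted_ltn_nth lt_trans o sB; move/(_ (index x A) (index y B)).
    rewrite !inE idxA // index_mem yB => /(_ isT isT lt_xy).
    by rewrite nth_index //= /lt /= ltnNge ltnW.
  have lt_iA : index y B < size A by apply: ltn_trans lt_i _; rewrite index_mem.
  exists (nth o A (index y B)); first by apply/memA; apply: mem_nth.
  by rewrite /phi index_uniq // nth_index.
- by move=> x y /memA xA /memA yA; apply: mono.
- by move=> x /memA; apply: h'_new.
- by move=> y y_new; apply: h'_old => x /memA; apply: y_new.
Qed.

Lemma copy_exists v q (g : gheap S) :
  exists (v' : value S) (g' : gheap S), copy v q g v' g'.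
Proof.
case: v => [o|o|w]; try by eexists; eexists; apply: CopyOther.
have [phi [h' gc]] := graph_copy_exists (g (home o)) o q (g q).
by eexists; eexists; apply: CopyObj gc.
Qed.

End Copying.

(** * Progress for expressions and statements *)

Section Progress.
Variable S : setting.
Implicit Types (p : Pl S) (e : expr S) (s : stmt S) (h : heap S) (g : gheap S).

Lemma expr_progress p h e : efv e = [::] -> ~ emisapplied p e ->
  (exists v, e = EVal v) \/ exists l k, estep p (Run e h) l k.
Proof.
elim/expr_nested_ind: e => //= [v|e f IH|fes IH|e IH|e IH]; first by left; exists v.
- move=> fv_e mis; right.
  have [|[v ev]|[l [k st]]] := IH fv_e; first by move/MisCtxField/mis.
    case: v ev mis => [o|o|w] -> mis; try by case: mis; apply: MisField.
    case E: (lookup h o f) => [v|]; eexists; eexists;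
      [exact: StepSelect E | exact: StepSelectBad].
  by eexists; eexists; apply: StepCtxField st.
- move=> fv mis; right.
  (* An evaluated prefix [vals] is carried along, so that the induction on the remaining fields can
     pass over each field that is already a value. *)
  suff scan rest (vals : seq (FieldName S * value S)) :
      foldr (fun fe => and (efv fe.2 = [::] -> ~ emisapplied p fe.2 ->
        (exists v, fe.2 = EVal v) \/ exists l k, estep p (Run fe.2 h) l k))
        True rest ->
      flatten [seq efv fe.2 | fe <- rest] = [::] ->
      ~ emisapplied p (ERec ([seq (fv.1, EVal fv.2) | fv <- vals] ++ rest)) ->
      exists l k, estep p
        (Run (ERec ([seq (fv.1, EVal fv.2) | fv <- vals] ++ rest)) h) l k.
    exact: (scan fes [::] IH).
  elim: rest vals => [|[f e] rest IHrest] vals.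
    move=> _ _ _; rewrite cats0; have [o [ho oh _]] := fresh_unbounded h p 0.
    by eexists; eexists; apply: StepNewObj ho oh.
  move=> /= [IHe /IHrest{}IHrest] fv_rest mis_rest.
  have [fv_e fv_rest'] : efv e = [::] /\ flatten [seq efv fe.2 | fe <- rest] = [::].
    by case: (efv e) fv_rest.
  have [|[v ev]|[l [k st]]] := IHe fv_e.
  - by move=> m; apply: mis_rest; apply: MisCtxRec m.
  - have snoc : [seq (fv.1, EVal fv.2) | fv <- vals] ++ (f, e) :: rest
        = [seq (fv.1, EVal fv.2) | fv <- rcons vals (f, v)] ++ rest.
      by rewrite map_rcons cat_rcons ev.
    by rewrite snoc in mis_rest *; apply: IHrest.
  - by eexists; eexists; apply: StepCtxRec st.
- move=> fv_e mis; right.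
  have [|[v ev]|[l [k st]]] := IH fv_e; first by move/MisCtxGlobalRef/mis.
    (* This leaves only object ids with home [p]; any other argument of [globalref] is
       misapplied. *)
    have bad w : w = v -> (forall o, home o = p -> w <> VObj o) -> False.
      by move=> -> H; apply: mis; rewrite ev; apply: MisGlobalRef.
    rewrite ev; case: v bad {ev} => [o|o|w] bad; try by case: (bad _ erefl).
    case: (eqVneq (home o) p) => [ho|/eqP nho].
      by eexists; eexists; apply: StepGlobalRef.
    by case: (bad _ erefl) => o' ho' [oo]; apply: nho; rewrite oo.
  by eexists; eexists; apply: StepCtxGlobalRef st.
- move=> fv_e mis; right.
  have [|[v ->]|[l [k st]]] := IH fv_e; first by move/MisCtxValOf/mis.
    case: v => [o|o|w]; try by eexists; eexists; apply: StepValOfBad.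
    (* In contrast to [globalref], a reference from another place is not excluded here: it raises
       [ExnBG]. *)
    case: (eqVneq (home o) p) => [ho|/eqP nho]; eexists; eexists.
      exact: StepValOf.
    by apply: StepValOfBad => o' ho' [oo]; apply: nho; rewrite oo.
  by eexists; eexists; apply: StepCtxValOf st.
Qed.

Lemma ctx_progress p g (C : expr S -> stmt S) e : expr_ctx C ->
  efv e = [::] -> ~ misapplied p (C e) ->
  (exists v, e = EVal v) \/ exists l k, step p (Run (C e) g) l k.
Proof.
move=> ctxC fv_e mis.
have [|[v ->]|[l [k st]]] := @expr_progress p (g p) e fv_e.
- by move/(MisCtx ctxC)/mis.
- by left; exists v.
- by right; eexists; eexists; apply: StepCtx ctxC st.
Qed.

Lemma progress p s g : sfv s = [::] -> scoped s -> ~ misapplied p s ->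
  exists l k, step p (Run s g) l k.
Proof.
(* The place is generalised as well, because the body of [SDynAt q] steps at [q]. *)
have [n] := ubnP (ssize s); elim: n => // n IH in p s g *.
have cat_nil (T : Type) (a b : seq T) : a ++ b = [::] -> a = [::] /\ b = [::].
  by case: a.
(* Scoping allows the body no free variable besides the bound one, so instantiating it yields a
   closed statement. *)
have closed_subst x v t :
    all (pred1 x) (sfv t) -> sfv (ssubst x v t) = [::].
  move=> /allP fv; rewrite sfv_ssubst.
  by apply/eqP; rewrite -[_ == _]negbK -has_filter; apply/hasPn=> z /fv /= ->.
case: s => [|w|x e s|e1 f e2|s t|q x e s|s|mu s|s t|q s|s] /=; rewrite ltnS => le_n.
- by move=> *; eexists; eexists; apply: StepSkip.
- by move=> *; eexists; eexists; apply: StepThrow.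
- move=> /cat_nil[fv_e _] /andP[fv_s sc] mis.
  have [[v ev]|//] := @ctx_progress p g _ e (CtxVal x s) fv_e mis.
  have [||||l [k st]] := IH p (ssubst x v s) g.
  + by rewrite ssize_ssubst.
  + exact: closed_subst.
  + exact: scoped_ssubst.
  + by move/MisVal => m; apply: mis; rewrite ev.
  by rewrite ev; eexists; eexists; apply: StepVal st.
- move=> /cat_nil[fv_e1 fv_e2] _ mis.
  have [[v ev]|//] := @ctx_progress p g _ e1 (CtxAssignL f e2) fv_e1 mis.
  move: mis; rewrite ev => mis.
  case: v ev mis => [o|o|w] ev mis; try by case: mis; apply: MisAssign.
  have [[v ->]|//] := @ctx_progress p g _ e2 (CtxAssignR o f) fv_e2 mis.
  case E: (lookup (g p) o f) => [w|]; last first.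
    by eexists; eexists; apply: StepAssignBad.
  move: E; rewrite /lookup; case Eo: (g p).[? o] => [r|] //= rf.
  by eexists; eexists; apply: StepAssign Eo _; rewrite -fndSome rf.
- move=> /cat_nil[fv_s _] /andP[sc _] mis.
  have [||||l [k st]] := IH p s g => //.
  + exact: leq_ltn_trans (leq_addr _ _) le_n.
  + by move/(MisSeq t)/mis.
  (* A synchronous exception discards [t]; the other two labels fall under the same rule. *)
  case: l st => [|w|w] st.
  + by eexists; eexists; apply: StepSeq st _.
  + by eexists; eexists; apply: StepSeqExn st.
  + by eexists; eexists; apply: StepSeq st _.
- move=> /cat_nil[fv_e _] _ mis.
  have [[v ->]|//] := @ctx_progress p g _ e (CtxAt q x s) fv_e mis.
  have [v' [g' cp]] := copy_exists v q g.
  by eexists; eexists; apply: StepPlaceShift cp.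
- by move=> *; eexists; eexists; apply: StepSpawn.
- move=> fv_s sc mis.
  (* Whether the body has terminated decides between (Finish) and (End of Finish). *)
  have [|l [[s' g'|g'] st]] := IH p s g le_n fv_s sc.
  + by move/(MisFinish mu)/mis.
  + by eexists; eexists; apply: StepFinish st.
  + by eexists; eexists; apply: StepEndFinish st.
- move=> /cat_nil[fv_s _] /andP[sc _] mis.
  have [||||l [k st]] := IH p s g => //.
  + exact: leq_ltn_trans (leq_addr _ _) le_n.
  + by move/(MisTry t)/mis.
  case: l st => [|w|w] st.
  + by eexists; eexists; apply: StepTry st _.
  + by eexists; eexists; apply: StepTryCatch st.
  + by eexists; eexists; apply: StepTry st _.
- move=> fv_s sc mis; have [|l [k st]] := IH q s g le_n fv_s sc.
    by move/(MisAt p)/mis.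
  by eexists; eexists; apply: StepAt st.
- move=> fv_s sc mis; have [|l [k st]] := IH p s g le_n fv_s sc.
    by move/MisAsync/mis.
  by eexists; eexists; apply: StepAsync st.
Qed.

End Progress.

Theorem proposition2p7 (S : setting) (p : Pl S) (k : sconfig S) :
  well_formed p k -> terminal p k -> exists g : gheap S, k = Done g.
Proof.
case: k => [s g [fv sc mis]|g _ _]; last by exists g.
by case; apply: progress.
Qed.
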